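(* Let $\mathcal{T} \cap K^*_{++} \ne \emptyset$, let $x_*$ be a locally optimal solution of the problem $(\mathcal{P})$, and let $f$ be Hölder continuous with constant $L > 0$ and exponent $\alpha > 0$ near $x_*$ (i.e. $f$ is finite and $|f(x) - f(y)| \le L\, d(x,y)^{\alpha}$ for all $x,y$ in some neighbourhood of $x_*$). Suppose also that there exist $\eta > 0$ and a neighbourhood $U$ of $x_*$ such that $$\| \varphi(x) \| \ge \eta \big( \operatorname{dist}(x, M \cap Q) \big)^{\alpha} \quad \forall x \in U \cap Q,$$ where $\operatorname{dist}(x, A) = \inf_{a \in A} d(x,a)$. Then the penalty function $\Phi_{\tau}$ is locally exact at $x_*$, and for any $\tau \in \mathcal{T} \cap K^*_{++}$ the vector $\dfrac{L}{\eta\, p_K(\tau)}\, \tau$ is a local exact penalty parameter at $x_*$.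
   Context: Setting. $(X,d)$ is a metric space, $M, Q \subseteq X$ satisfy $M \cap Q \neq \emptyset$, and $f \colon X \to \mathbb{R} \cup \{+\infty\}$. Problem $(\mathcal{P})$: minimize $f(x)$ subject to $x \in M \cap Q$. It is assumed that $(\mathcal{P})$ has a globally optimal solution and that its optimal value is finite. $Y$ is a real normed space, $K \subset Y$ is a closed convex pointed cone ($K \cap (-K) = \{0\}$) with $K \ne \{0\}$. An improper element $\infty$ is added to $Y$, with $\|\infty\| = +\infty$. $\varphi \colon X \to K \cup \{\infty\}$ is a function such that $\varphi(x) = 0$ iff $x \in M$. $Y^*$ is the topological dual, $\langle\cdot,\cdot\rangle$ is the duality pairing, $K^* = \{y^* \in Y^* : \langle y^*, y\rangle \ge 0 \ \forall y \in K\}$, and $K^*_+ = \{y^* \in K^* : \langle y^*, y \rangle > 0 \ \forall y \in K \setminus \{0\}\}$, assumed nonempty. $K^*_{++}$ is the set of all $\tau \in K^*_+$ for which there exists $c>0$ with $\langle \tau, y\rangle \ge c\|y\|$ for all $y \in K$; the supremum of all such $c$ is denoted $p_K(\tau)$. $\mathcal{T} \subset K^*_+$ is a fixed nonempty set with $\alpha\tau \in \mathcal{T}$ for all $\tau \in \mathcal{T}$, $\alpha>0$. For $\tau \in \mathcal{T}$, $\Phi_\tau(x) = f(x) + \langle \tau, \varphi(x)\rangle$, where $\langle \tau, \infty\rangle = +\infty$. Problem $(\mathcal{P}_\tau)$: minimize $\Phi_\tau(x)$ subject to $x \in Q$. Write $\tau \succeq_{K^*} \tau_*$ iff $\tau -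 \tau_* \in K^*$. Local exactness. If $x_*$ is a locally optimal solution of $(\mathcal{P})$, $\Phi_\tau$ is locally exact at $x_*$ if there is $\tau_* \in \mathcal{T}$ such that for all $\tau \in \mathcal{T}$ with $\tau \succeq_{K^*} \tau_*$ the point $x_*$ is a locally optimal solution of $(\mathcal{P}_\tau)$. Any such $\tau_*$ is called a local exact penalty parameter at $x_*$. *)

(* Defs.v *)
From HB Require Import structures.
From mathcomp Require Import all_boot all_order all_algebra.
From mathcomp Require Import all_classical all_reals all_analysis.

Set Implicit Arguments.
Unset Strict Implicit.
Unset Printing Implicit Defensive.

Import Order.TTheory GRing.Theory Num.Theory.
Import numFieldNormedType.Exports.

Local Open Scope classical_set_scope.
Local Open Scope ring_scope.

Section Optimization.
Variables (R : realType) (X : metricType R).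

Definition global_solution (F : X -> \bar R) (A : set X) (x : X) : Prop :=
  A x /\ forall y, A y -> (F x <= F y)%E.

Definition local_solution (F : X -> \bar R) (A : set X) (x : X) : Prop :=
  A x /\ \forall y \near x, A y -> (F x <= F y)%E.

Definition optimal_value (F : X -> \bar R) (A : set X) : \bar R :=
  ereal_inf (F @` A).

(* Meaningful for nonempty [A] only: the real-valued [inf] of the empty set
   is 0. *)
Definition dist_to (x : X) (A : set X) : R := inf [set mdist x a | a in A].

Definition hoelder_near (f : X -> \bar R) (L alpha : R) (x0 : X) : Prop :=
  exists V : set X, [/\ nbhs x0 V,
    forall x, V x -> f x \is a fin_num &
    forall x y, V x -> V y ->
      `|fine (f x) - fine (f y)| <= L * mdist x y `^ alpha].

End Optimization.

Section DualCones.
Variables (R : realType) (Y : normedModType R).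

(* Functionals are plain functions into the regular module [R^o], so that the
   pointwise operations [tau - sigma] and [a *: tau] are available. *)
Definition topological_dual : set (Y -> R^o) :=
  [set l | linear l /\ continuous l].

(* The empty set and the cones without 0 are excluded by pointedness. *)
Definition closed_convex_pointed_cone (K : set Y) : Prop :=
  [/\ closed K,
      @convex_set R Y K,
      (forall (t : R) y, 0 < t -> K y -> K (t *: y)) &
      K `&` [set - y | y in K] = [set 0]].

Variable K : set Y.

Definition dual_cone : set (Y -> R^o) :=
  [set l | topological_dual l /\ forall y, K y -> 0 <= l y].

Definition dual_cone_pos : set (Y -> R^o) :=
  [set l | dual_cone l /\ forall y, (K `\ 0) y -> 0 < l y].

Definition lower_constants (tau : Y -> R^o) : set R :=
  [set c | 0 < c /\ forall y, K y -> c * `|y| <= tau y].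

Definition dual_cone_unif_pos : set (Y -> R^o) :=
  [set tau | dual_cone_pos tau /\ lower_constants tau !=set0].

(* When [K] contains a nonzero vector and [tau] is in [dual_cone_unif_pos],
   this set is nonempty and bounded above, so [sup] is the true supremum. *)
Definition pK (tau : Y -> R^o) : R := sup (lower_constants tau).

Definition dual_order (tau tau0 : Y -> R^o) : Prop := dual_cone (tau - tau0).

End DualCones.

(* The extension of [Y] by the improper element is [option Y], with [None] as
   the improper element. *)
Definition ext_norm (R : realType) (Y : normedModType R) (z : option Y)
  : \bar R := if z is Some y then `|y|%:E else +oo%E.

Definition ext_pairing (R : realType) (Y : normedModType R) (tau : Y -> R^o)
  (z : option Y) : \bar R := if z is Some y then (tau y)%:E else +oo%E.

Section Penalty.
Variables (R : realType) (X : metricType R) (Y : normedModType R).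
Variables (f : X -> \bar R) (phi : X -> option Y).

Definition penalty (tau : Y -> R^o) (x : X) : \bar R :=
  (f x + ext_pairing tau (phi x))%E.

Variables (Q : set X) (K : set Y) (T : set (Y -> R^o)).

Definition local_exact_parameter (x : X) (tau0 : Y -> R^o) : Prop :=
  T tau0 /\
  forall tau, T tau -> dual_order K tau tau0 ->
    local_solution (penalty tau) Q x.

Definition locally_exact (x : X) : Prop :=
  exists tau0, local_exact_parameter x tau0.

End Penalty.

(* Main.v *)
Require Import Defs.
From HB Require Import structures.
From mathcomp Require Import all_boot all_order all_algebra.
From mathcomp Require Import all_classical all_reals all_analysis.
From mathcomp Require Import lra.
Import Order.TTheory GRing.Theory Num.Theory.
Import numFieldNormedType.Exports.
Local Open Scope classical_set_scope.
Local Open Scope ring_scope.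

(** The penalty term dominates the possible decrease of the objective.  Let [A]
    be the feasible set.  For [x] close to [xs], points [a] of [A] that almost
    realize the distance from [x] to [A] are still close to [xs], because [xs]
    itself is a competitor in the infimum; there [f xs <= f a], and the Hoelder
    condition bounds [f a] by [f x + L * mdist x a `^ alpha].  Passing to the
    infimum over [a] yields [f xs <= f x + L * dist_to x A `^ alpha]
    ([local_solution_dist_bound]).  The error bound on [phi] replaces the
    distance term by [L / eta * `|phi x|], and uniform positivity of [tau] on
    [K] replaces [`|phi x|] by [tau (phi x) / pK K tau], since the supremum
    defining [pK K tau] is itself a lower constant ([pK_lower_constant]).
    Hence [f xs <= penalty sigma x] for [sigma := (L / (eta * pK K tau)) *: tau]
    and a fortiori for every functional above [sigma] in the dual order, while
    [f xs] is the value of the penalty function at [xs] as [phi xs] is the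
    origin. *)

Lemma dist_to_le {R : realType} {X : metricType R} {A : set X} (x a : X) :
  A a -> dist_to x A <= mdist x a.
Proof.
by move=> Aa; apply: ge_inf; [exists 0 => _ [b _ <-]; exact: mdist_ge0|exists a].
Qed.

Lemma dist_to_ge0 {R : realType} {X : metricType R} (x : X) {A : set X} :
  A !=set0 -> 0 <= dist_to x A.
Proof.
move=> [a Aa]; apply: lb_le_inf; first by exists (mdist x a), a.
by move=> _ [b _ <-]; exact: mdist_ge0.
Qed.

Lemma dist_to_lt {R : realType} {X : metricType R} {A : set X} (x : X) (s : R) :
  A !=set0 -> dist_to x A < s -> exists2 a, A a & mdist x a < s.
Proof.
move=> [a Aa] /inf_lt[|_ [b Ab <-] ?]; first by exists (mdist x a), a.
by exists b.
Qed.

(** The distance to [A] need not be attained, so the estimate is obtained by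
    contradiction: a strict violation leaves room to choose a point of [A]
    whose distance to [x] is slightly larger than [dist_to x A]. *)
Lemma local_solution_dist_bound {R : realType} {X : metricType R}
  (f : X -> \bar R) (A : set X) (L alpha : R) (xs : X) :
  0 < L -> 0 < alpha -> local_solution f A xs -> hoelder_near f L alpha xs ->
  \forall x \near xs, f x \is a fin_num /\
    fine (f xs) <= fine (f x) + L * dist_to x A `^ alpha.
Proof.
move=> L0 alpha0 [Axs xs_min] [V [Vxs fV f_hoelder]].
have /nbhs_ballP[r /= r0 rV] : \forall x \near xs, V x /\ (A x -> (f xs <= f x)%E).
  by apply: filterI.
have r20 : 0 < r / 2 by rewrite divr_gt0.
apply/nbhs_ballP; exists (r / 2) => //= x xsx.
have Vx : V x by apply: (rV x _).1; apply: le_ball xsx; lra.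
have A0 : A !=set0 by exists xs.
split; first exact: fV.
rewrite -lerBlDl leNgt; apply/negP => violation.
set w := _ - _ in violation.
have w0 : 0 < w by rewrite (le_lt_trans _ violation)// mulr_ge0 ?powR_ge0// ltW.
(* the distance at which the Hoelder bound allows exactly the decrease [w] *)
pose s := (w / L) `^ alpha^-1.
have s_alpha : s `^ alpha = w / L.
  by rewrite -powRrM mulVf ?gt_eqF// powRr1// divr_ge0// ltW.
have Ds : dist_to x A < s.
  rewrite ltNge; apply/negP => /(ge0_ler_powR (ltW alpha0)).
  rewrite !nnegrE powR_ge0 dist_to_ge0// => /(_ isT isT).
  by rewrite s_alpha ler_pdivrMr// leNgt mulrC violation.
have Dr : dist_to x A < r / 2.
  rewrite (le_lt_trans (dist_to_le x xs Axs))// metric_sym.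
  by move: xsx; rewrite ballEmdist.
have [|a Aa] := @dist_to_lt _ _ A x (Num.min s (r / 2)) A0.
  by rewrite lt_min Ds.
rewrite lt_min => /andP[xas xar].
have [Va /(_ Aa) fxs_fa] : V a /\ (A a -> (f xs <= f a)%E).
  by apply: rV; apply: ball_split xsx _; rewrite ballEmdist.
have {fxs_fa} : fine (f xs) <= fine (f a).
  by rewrite fine_le ?fV//; exact: nbhs_singleton.
have := f_hoelder _ _ Vx Va; rewrite distrC => /(le_trans (ler_norm _)).
have : L * mdist x a `^ alpha < w.
  rewrite mulrC -ltr_pdivlMr// -s_alpha gt0_ltr_powR// nnegrE ?mdist_ge0//.
  exact: powR_ge0.
rewrite /w; lra.
Qed.

(** For each nonzero [y] in [K], every lower constant is at most
    [tau y / `|y|], so their supremum is too: it is itself a lower constant. A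
    nonzero vector in [K] is what makes the supremum finite. *)
Lemma pK_lower_constant {R : realType} {Y : normedModType R} {K : set Y}
  {tau : Y -> R^o} :
  (exists2 y, K y & y != 0) -> dual_cone_unif_pos K tau ->
  lower_constants K tau (pK K tau).
Proof.
move=> [y0 Ky0 y0_neq0] [_ [c c_lower]]; have [c0 ctau] := c_lower.
split.
  rewrite (lt_le_trans c0)//; apply: sup_upper_bound => //.
  split; first by exists c.
  exists (tau y0 / `|y0|) => d [_ /(_ y0 Ky0)].
  by rewrite ler_pdivlMr ?normr_gt0.
move=> y; have [-> /ctau|y_neq0 Ky] := eqVneq y 0; first by rewrite normr0 !mulr0.
rewrite -ler_pdivlMr ?normr_gt0//; apply: ge_sup; first by exists c.
by move=> d [_ /(_ y Ky)]; rewrite ler_pdivlMr ?normr_gt0.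
Qed.

Lemma pointed_cone_nontrivial {R : realType} {Y : normedModType R} (K : set Y) :
  closed_convex_pointed_cone K -> K <> [set 0] -> exists2 y, K y & y != 0.
Proof.
move=> [_ _ _ pointed] K_nontriv; apply: contrapT => no; apply: K_nontriv.
have K0 : K 0.
  by have : (K `&` [set - y | y in K]) 0 by [rewrite pointed]; case.
apply/seteqP; split => [y Ky|_ ->//]; apply: contrapT => /eqP y0.
by apply: no; exists y.
Qed.

Theorem proposition1 (R : realType) (X : metricType R) (Y : normedModType R)
  (M Q : set X) (f : X -> \bar R)
  (K : set Y) (phi : X -> option Y) (T : set (Y -> R^o))
  (MQ0 : M `&` Q !=set0)
  (f_ninfty : forall x, f x != -oo%E)
  (P_solvable : exists x, global_solution f (M `&` Q) x)
  (P_finite : optimal_value f (M `&` Q) \is a fin_num)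
  (K_cone : closed_convex_pointed_cone K)
  (K_nontriv : K <> [set 0])
  (phi_K : forall x y, phi x = Some y -> K y)
  (phi_M : forall x, phi x = Some 0 <-> M x)
  (Kpos0 : dual_cone_pos K !=set0)
  (T0 : T !=set0)
  (T_pos : T `<=` dual_cone_pos K)
  (T_scale : forall (tau : Y -> R^o) (a : R), T tau -> 0 < a -> T (a *: tau))
  (TK0 : T `&` dual_cone_unif_pos K !=set0)
  (xs : X) (xs_loc : local_solution f (M `&` Q) xs)
  (L alpha : R) (L_gt0 : 0 < L) (alpha_gt0 : 0 < alpha)
  (f_hoelder : hoelder_near f L alpha xs)
  (eta : R) (eta_gt0 : 0 < eta)
  (U : set X) (U_nbhs : nbhs xs U)
  (phi_bound : forall x, (U `&` Q) x ->
     ((eta * dist_to x (M `&` Q) `^ alpha)%:E <= ext_norm (phi x))%E) :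
  locally_exact f phi Q K T xs /\
  forall tau : Y -> R^o, (T `&` dual_cone_unif_pos K) tau ->
    local_exact_parameter f phi Q K T xs ((L / (eta * pK K tau)) *: tau).
Proof.
have K_nz := pointed_cone_nontrivial _ K_cone K_nontriv.
suff param (tau : Y -> R^o) : (T `&` dual_cone_unif_pos K) tau ->
    local_exact_parameter f phi Q K T xs ((L / (eta * pK K tau)) *: tau).
  split=> //; have [tau Ttau] := TK0.
  by exists ((L / (eta * pK K tau)) *: tau); exact: param.
move=> [Ttau tauK]; have [p0 p_le] := pK_lower_constant K_nz tauK.
split; first by apply: T_scale => //; rewrite divr_gt0// mulr_gt0.
move=> sigma Tsigma [_ sigma_ge].
have [[Mxs Qxs] _] := xs_loc.
have [fxs _] := nbhs_singleton
  (local_solution_dist_bound f _ _ _ _ L_gt0 alpha_gt0 xs_loc f_hoelder).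
have sigma0 : sigma 0 = 0.
  have [[[sigma_lin _] _] _] := T_pos _ Tsigma.
  by have := sigma_lin (-1) 0 0; rewrite scaler0 addr0 scaleN1r addNr.
split=> //.
have := local_solution_dist_bound f _ _ _ _ L_gt0 alpha_gt0 xs_loc f_hoelder.
apply: filterS2 U_nbhs => x Ux [fx f_le] Qx.
rewrite /penalty ((phi_M xs).2 Mxs) /= sigma0 adde0.
have := phi_bound x (conj Ux Qx).
case phix : (phi x) => [y|] /=; last first.
  by move=> _; rewrite addey ?leey.
rewrite lee_fin => y_ge; have Ky := phi_K _ _ phix.
rewrite -(fineK fxs) -(fineK fx) -EFinD lee_fin (le_trans f_le)// lerD2l.
have : L / (eta * pK K tau) * tau y <= sigma y.
  by have := sigma_ge y Ky; rewrite subr_ge0.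
apply: le_trans.
rewrite -mulrA ler_pM2l// -(ler_pM2l eta_gt0) (le_trans y_ge)//.
by rewrite invfM -!mulrA mulVKf ?gt_eqF// ler_pdivlMl// p_le.
Qed.
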